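(* Let $G$ be an Eulerian digraph and let $\varepsilon=\{Q_1,\ldots,Q_r\}$ be any biclique partition of $G$. Then, for every $u\in V(G)$ and every $i=1,\ldots,r$, $$\kappa_u(G)=\frac{\prod_{v\in V(G)}d_v^+(G)}{\prod_{j=1}^r|Q_j^{(2)}|}\cdot\frac{t_{Q_i}(\Theta(\varepsilon))}{|Q_i^{(1)}|},$$ $$\mathcal{E}(G)=\frac{\prod_{v\in V(G)}\bigl(d_v^+(G)!\bigr)}{\prod_{j=1}^r|Q_j^{(2)}|}\cdot\frac{t_{Q_i}(\Theta(\varepsilon))}{|Q_i^{(1)}|},$$ where $\Theta(\varepsilon)$ is the weighted biclique digraph of $\varepsilon$ defined in the context.
   Context: A digraph $G$ has a finite vertex set $V(G)$ and an edge set $E(G)$ of ordered pairs; $ij\in E(G)$ means there is a directed edge from tail $i$ to head $j$. $d_u^+(G)$ and $d_u^-(G)$ denote the outdegree and indegree of $u$. An Eulerian digraph is a connected digraph with $d_u^+(G)=d_u^-(G)$ for every vertex $u$. $\mathcal{E}(G)$ is the number of Eulerian circuits of $G$ (closed directed trails using every edge exactly once, counted up to cyclic rotation, i.e. up to the choice of starting edge). An oriented spanning tree of a (weighted) digraph $G$ with root $u$ is a subtree containing all vertices of $G$ in which $u$ has outdegree $0$ and every other vertex has outdegree $1$ (all edges point towards the root). $\mathbb{T}_u(G)$ is the set of oriented spanning trees of $G$ with root $u$, $\kappa_u(G)=|\mathbb{T}_u(G)|$, and for a weighted digraph with edge weights $w_e(G)$, $t_u(G)=\sum_{T\in\mathbb{T}_u(G)}\prod_{e\in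 E(T)}w_e(G)$. A biclique is a bipartite digraph $Q$ whose vertices are partitioned into two (nonempty, disjoint) parts $Q^{(1)},Q^{(2)}$ with $E(Q)=\{ij:i\in Q^{(1)},j\in Q^{(2)}\}$. A biclique partition of $G$ is a set $\varepsilon=\{Q_1,\ldots,Q_r\}$ of bicliques in $G$ (subdigraphs of $G$) such that each edge of $G$ belongs to exactly one biclique of $\varepsilon$. $\Theta(\varepsilon)$ is the weighted digraph with vertex set $\{Q_1,\ldots,Q_r\}$ and edge set $\{Q_iQ_j:Q_i^{(2)}\cap Q_j^{(1)}\neq\emptyset\}$, where the edge $Q_iQ_j$ has weight $$w_{Q_iQ_j}(\Theta(\varepsilon))=|Q_j^{(2)}|\sum_{u\in Q_i^{(2)}\cap Q_j^{(1)}}\frac{1}{d_u^+(G)}.$$ *)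

(* Defs.v *)
From mathcomp Require Import all_boot all_order all_algebra.

Set Implicit Arguments.
Unset Strict Implicit.
Unset Printing Implicit Defensive.

Import GRing.Theory.

Local Open Scope ring_scope.

(* A digraph is given by its finite type V of vertices and its set of edges
   E : {set V * V}; the pair (x, y) is the edge with tail x and head y. *)
Section Digraph.
Variable V : finType.
Implicit Types (E T : {set V * V}) (u v : V).

Definition outdeg E u : nat := #|[set v | (u, v) \in E]|.
Definition indeg E u : nat := #|[set v | (v, u) \in E]|.

Definition adjacent E : rel V :=
  [rel x y | ((x, y) \in E) || ((y, x) \in E)].

Definition connected E : bool :=
  [forall x, forall y, connect (adjacent E) x y].

Definition eulerian E : Prop :=
  connected E /\ forall u, outdeg E u = indeg E u.

(* Cycles of the underlying undirected multigraph: the first two conjuncts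
   exclude lengths 1 and 2 (a loop, a pair of opposite edges), the last one all
   lengths n >= 3; a cycle has no repeated vertex, whence n <= #|V|. *)
Definition acyclic E : bool :=
  [&& [forall x, (x, x) \notin E],
      [forall x, forall y, ~~ [&& x != y, (x, y) \in E & (y, x) \in E]] &
      [forall n : 'I_#|V|.+1, forall c : n.-tuple V,
         (2 < n)%N ==> ~~ (cycle (adjacent E) c && uniq c)]].

Definition is_tree E : bool := connected E && acyclic E.

(* A spanning subtree is identified with its set of edges. *)
Definition oriented_spanning_tree E u T : bool :=
  [&& T \subset E, is_tree T, outdeg T u == 0%N &
      [forall v, (v != u) ==> (outdeg T v == 1%N)]].

Definition spanning_trees E u : {set {set V * V}} :=
  [set T | oriented_spanning_tree E u T].

Definition kappa E u : nat := #|spanning_trees E u|.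

Definition weighted_tree_sum E (w : V * V -> rat) u : rat :=
  \sum_(T in spanning_trees E u) \prod_(e in T) w e.

(* Closed trails traversing each edge exactly once, with a starting edge. *)
Definition rooted_eulerian_circuits E : {set #|E|.-tuple (V * V)} :=
  [set s : #|E|.-tuple (V * V) |
     [&& cycle (fun e f : V * V => e.2 == f.1) s, uniq s & [set:: s] == E]].

Definition rotation_of E : rel (#|E|.-tuple (V * V)) :=
  fun s t => [exists k : 'I_#|E|.+1, rot k s == t :> seq (V * V)].

Definition num_eulerian_circuits E : nat :=
  #|equivalence_partition (@rotation_of E) (rooted_eulerian_circuits E)|.

(* A pair (A, B) of vertex sets stands for the biclique with parts
   Q^(1) = A and Q^(2) = B. *)
Definition is_biclique (Q : {set V} * {set V}) : Prop :=
  [/\ Q.1 != set0, Q.2 != set0 & [disjoint Q.1 & Q.2]].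

Definition biclique_edges (Q : {set V} * {set V}) : {set V * V} :=
  setX Q.1 Q.2.

(* The uniqueness of j forces the Q j to be pairwise distinct, so such families
   are exactly the enumerations of biclique partitions seen as sets. *)
Definition biclique_partition E (r : nat) (Q : 'I_r -> {set V} * {set V}) :
    Prop :=
  (forall j, is_biclique (Q j) /\ biclique_edges (Q j) \subset E) /\
  (forall e, e \in E -> exists! j, e \in biclique_edges (Q j)).

(* The weighted digraph Theta, with j standing for the vertex Q j. *)
Definition Theta_edges (r : nat) (Q : 'I_r -> {set V} * {set V}) :
    {set 'I_r * 'I_r} :=
  [set ij | (Q ij.1).2 :&: (Q ij.2).1 != set0].

Definition Theta_weight E (r : nat) (Q : 'I_r -> {set V} * {set V})
    (ij : 'I_r * 'I_r) : rat :=
  #|(Q ij.2).2|%:R *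
  \sum_(u in (Q ij.1).2 :&: (Q ij.2).1) (outdeg E u)%:R^-1.

End Digraph.

(* Main.v *)
Require Import Defs.
From mathcomp Require Import all_boot all_order all_algebra.
From mathcomp Require Import perm ring.

(* Choosing a uniform out-edge of v in two stages, first the biclique Q_j and
   then the head in Q_j^(2), writes the random walk on G as Y X, where
   Y : V -> bicliques and X : bicliques -> V are stochastic matrices; the walk X Y
   in the opposite order has transition probabilities w_ij / |Q_i^(2)|. By the
   matrix-tree theorem the two rooted tree sums are the determinants of 1 - Y X
   and 1 - X Y with the row of the root deleted from the walk, and
   det (1 - A B) = det (1 - B A) turns the second one into a rank-one perturbation
   of 1 - Y X, which is evaluated with the left kernel vector (d_v) and the right
   kernel vector 1. The formula for circuits then follows from the BEST theorem. *)

Set Implicit Arguments.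
Unset Strict Implicit.
Unset Printing Implicit Defensive.

Import GRing.Theory.

Local Open Scope ring_scope.

(** * Determinants of rank-one perturbations *)

(** The block matrix with rows (1, A) and (B, 1) factors into block triangular matrices in two ways,
    by eliminating [B] or by eliminating [A]. *)
Lemma det_1sub_mulmxC (R : comNzRingType) m n (A : 'M[R]_(m, n)) (B : 'M_(n, m)) :
  \det (1%:M - A *m B) = \det (1%:M - B *m A).
Proof.
have eqL : block_mx 1%:M A B 1%:M
    = block_mx (1%:M - A *m B) A 0 1%:M *m block_mx 1%:M 0 B 1%:M.
  by rewrite mulmx_block !mulmx1 !mul0mx !mul1mx mulmx0 subrK !add0r.
have eqR : block_mx 1%:M A B 1%:M
    = block_mx 1%:M 0 B 1%:M *m block_mx 1%:M A 0 (1%:M - B *m A).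
  by rewrite mulmx_block !mulmx1 !mul0mx !mul1mx !addr0 addrC subrK.
have := congr1 determinant (etrans (esym eqL) eqR).
by rewrite !det_mulmx !det_ublock !det_lblock !det1 !mulr1 !mul1r.
Qed.

Lemma det_add1_mulmx_rank1 (R : comNzRingType) n (x : 'cV[R]_n) (y : 'rV_n) :
  \det (1%:M + x *m y) = 1 + (y *m x) 0 0.
Proof.
rewrite -[x *m y]opprK -mulNmx det_1sub_mulmxC det_mx11.
by rewrite mulmxN opprK !mxE eqxx.
Qed.

Section Rank1.
Variables (F : fieldType) (n : nat) (N : 'M[F]_n) (k : 'I_n).

Definition set_row (w : 'rV[F]_n) (M : 'M_n) : 'M_n :=
  \matrix_(i, j) if i == k then w 0 j else M i j.

(* Both sides are the determinant of [N + x w] with row [k] replaced by the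
   combination [d (N + x w) = (d x) w] of its rows. *)
Lemma det_add_rank1 (d w : 'rV[F]_n) (x : 'cV_n) : d *m N = 0 ->
  d 0 k * \det (N + x *m w) = (d *m x) 0 0 * \det (set_row w N).
Proof.
move=> dN.
(* [P] is the identity with row [k] replaced by [d], and [1%:M + x' *m delta_mx 0 k] is the identity
   with column [k] replaced by [x] off the diagonal and by [dx] on it. The first times [N + x *m w]
   equals the second times [set_row w N]. *)
pose P : 'M[F]_n := 1%:M + delta_mx k 0 *m (d - delta_mx 0 k).
pose dx := (d *m x) 0 0.
pose x' : 'cV[F]_n := \col_i (if i == k then dx - 1 else x i 0).
have dP : \det P = d 0 k.
  by rewrite det_add1_mulmx_rank1 -colE !mxE !eqxx /= mulr1n addrCA subrr addr0.
have dQ : \det (1%:M + x' *m delta_mx 0 k) = dx.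
  by rewrite det_add1_mulmx_rank1 -rowE !mxE eqxx /= ?mulr1n addrCA subrr addr0.
rewrite -dP -/dx -dQ -!det_mulmx; congr (\det _).
have dZ : d *m (N + x *m w) = dx *: w.
  by rewrite mulmxDr dN add0r mulmxA [d *m x]mx11_scalar mul_scalar_mx.
rewrite !mulmxDl !mul1mx -!mulmxA mulmxBl dZ -!rowE.
apply/matrixP=> i j; rewrite !mxE !big_ord1 !mxE !andbT eqxx.
have [->|_] := eqVneq i k; last by rewrite mul0r addr0.
by rewrite big_ord1 mulr1n -[ord0]/(0 : 'I_1); ring.
Qed.

(** By linearity in row [k], split [w] into its entry sum times a unit row and a remainder [z] of
    entry sum 0. With [z] as row [k] the matrix kills the constant vector, so its determinant
    vanishes. *)
Lemma det_set_row (w : 'rV[F]_n) : N *m const_mx 1 = 0 :> 'cV_n ->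
  \det (set_row w N) = (\sum_j w 0 j) * \det (set_row (delta_mx 0 k) N).
Proof.
move=> N1; set s := \sum_j _.
pose z := w - s *: delta_mx 0 k.
have -> : \det (set_row w N)
    = s * \det (set_row (delta_mx 0 k) N) + 1 * \det (set_row z N).
  apply: (@determinant_multilinear _ _ _ _ _ k).
  - by apply/rowP=> j; rewrite !mxE eqxx; ring.
  - by apply/matrixP=> i j; rewrite !mxE eq_sym (negPf (neq_lift _ _)).
  - by apply/matrixP=> i j; rewrite !mxE eq_sym (negPf (neq_lift _ _)).
suff /eqP-> : \det (set_row z N) == 0 by rewrite mulr0 addr0.
rewrite -det_tr; apply/det0P; exists (const_mx 1).
  by apply/eqP=> /rowP/(_ k); rewrite !mxE => /eqP; rewrite oner_eq0.
rewrite -trmx_const -trmx_mul -[RHS]trmx0; congr (_^T); apply/colP=> i.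
rewrite !mxE; have [->|ik] := eqVneq i k.
  rewrite (eq_bigr (fun j => w 0 j - s * (j == k)%:R)); last first.
    by move=> j _; rewrite !mxE !eqxx mulr1.
  have e1 : \sum_(j < n) (j == k)%:R = 1 :> F.
    by rewrite (bigD1 k) //= eqxx big1 ?addr0 // => j /negPf->.
  by rewrite sumrB -mulr_sumr e1 mulr1 subrr.
move/colP: N1 => /(_ i); rewrite !mxE => N1i; rewrite -[RHS]N1i.
by apply: eq_bigr => j _; rewrite !mxE (negPf ik).
Qed.
End Rank1.

(** * Matrices indexed by finite types *)

Section FinMatrix.
Variable R : comNzRingType.

Definition fmx (I J : finType) (F : I -> J -> R) : 'M[R]_(#|I|, #|J|) :=
  \matrix_(i, j) F (enum_val i) (enum_val j).

Lemma eq_fmx (I J : finType) (F G : I -> J -> R) : F =2 G -> fmx F = fmx G.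
Proof. by move=> FG; apply/matrixP=> i j; rewrite !mxE. Qed.

Lemma fmxM (I J K : finType) (F : I -> J -> R) (G : J -> K -> R) :
  fmx F *m fmx G = fmx (fun i k => \sum_j F i j * G j k).
Proof.
apply/matrixP=> i k; rewrite !mxE.
rewrite (big_enum_val (fun j => F (enum_val i) j * G j (enum_val k))) /=.
by apply: eq_bigr => j _; rewrite !mxE.
Qed.

Lemma fmx1B (I : finType) (F : I -> I -> R) :
  1%:M - fmx F = fmx (fun a b => (a == b)%:R - F a b).
Proof. by apply/matrixP=> i j; rewrite !mxE (inj_eq enum_val_inj). Qed.

Lemma det_fmx (I : finType) (F : I -> I -> R) :
  \det (fmx F) = \sum_(s : 'S_#|I|)
    (-1) ^+ s * \prod_a F a (enum_val (s (enum_rank a))).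
Proof.
apply: eq_bigr => s _; congr (_ * _).
rewrite (big_enum_val (fun a => F a (enum_val (s (enum_rank a))))) /=.
by apply: eq_bigr => i _; rewrite mxE enum_valK.
Qed.

(** Multilinearity in the rows: expanding every row at once amounts to choosing one summand [f a]
    for each row [a]. *)
Lemma det_fmx_sum (I K : finType) (c : I -> K -> R) (G : I -> K -> I -> R) :
  \det (fmx (fun a b => \sum_k c a k * G a k b))
  = \sum_(f : {ffun I -> K})
      (\prod_a c a (f a)) * \det (fmx (fun a b => G a (f a) b)).
Proof.
rewrite det_fmx; under eq_bigr do rewrite bigA_distr_bigA big_distrr /=.
rewrite exchange_big; apply: eq_bigr => f _ /=.
rewrite det_fmx big_distrr /=; apply: eq_bigr => s _.
by rewrite big_split /= mulrCA.
Qed.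
End FinMatrix.

(** * The matrix-tree theorem for parent functions *)

Lemma fconnect_ind (V : finType) (f : V -> V) (u : V) (P : V -> Prop) :
  P u -> (forall v, v != u -> P (f v) -> P v) ->
  forall v, fconnect f v u -> P v.
Proof.
move=> Pu Pf v /iter_findex; move: (findex _ _ _) => k.
elim: k v => [|k IHk] v; first by move=> /= ->.
rewrite iterSr => /IHk Pfv.
by have [->|vu] := eqVneq v u; [|apply: Pf].
Qed.

Section MatrixTree.
Variables (V : finType) (u : V).

(** Parent functions of trees oriented towards [u]. The root has no parent; making it a fixed point
    lets the tree determine the function. *)
Definition rooted_map : pred {ffun V -> V} :=
  [pred f : {ffun V -> V} | (f u == u) && [forall v, fconnect f v u]].

Lemma rooted_map_no_fix (f : {ffun V -> V}) v :
  f \in rooted_map -> v != u -> f v != v.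
Proof.
case/andP=> _ /forallP/(_ v) /iter_findex; set k := findex _ _ _.
move=> fk vu; apply: contraNneq vu => fv.
by rewrite -fk; apply/eqP; elim: k {fk} => //= k <-.
Qed.

(* For a rooted map the identity is the only permutation contributing to the
   determinant: a moved vertex would have to be sent to its parent, forcing all
   its ancestors, hence [u], to move. Otherwise the indicator function of the
   vertices that never reach [u] is in the kernel. *)
Lemma det_1sub_map (F : fieldType) (f : {ffun V -> V}) : f u = u ->
  \det (fmx (fun a b => (a == b)%:R - ((a != u) && (b == f a))%:R)) =
  (f \in rooted_map)%:R :> F.
Proof.
move=> fu; have [fr|] := boolP (f \in rooted_map); last first.
  rewrite inE /= fu eqxx => /forallPn[z zu].
  apply/eqP; rewrite -det_tr; apply/det0P.
  pose c (v : V) : F := (~~ fconnect f v u)%:R.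
  exists (\row_i c (enum_val i)).
    apply/eqP=> /rowP/(_ (enum_rank z)); rewrite !mxE enum_rankK /c zu => /eqP.
    by rewrite oner_eq0.
  apply/rowP=> i; rewrite !mxE; set a := enum_val i.
  rewrite (eq_bigr (fun j => c (enum_val j) *
    ((a == enum_val j)%:R - ((a != u) && (enum_val j == f a))%:R))); last first.
    by move=> j _; rewrite !mxE.
  rewrite -(big_enum_val (fun b => c b * ((a == b)%:R - ((a != u) && (b == f a))%:R))) /=.
  under eq_bigr do rewrite mulrBr.
  have pick1 (x : V) : \sum_b c b * (b == x)%:R = c x.
    rewrite (bigD1 x) //= eqxx mulr1 big1 ?addr0 // => b /negPf->.
    by rewrite mulr0.
  rewrite sumrB; under eq_bigr do rewrite eq_sym.
  rewrite pick1; have [->|au] /= := eqVneq a u.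
    by rewrite big1 => [|b _]; rewrite ?mulr0 // /c connect0 subr0.
  by rewrite pick1 /c (fconnect_eqVf f a) (negPf au) subrr.
rewrite det_fmx (bigD1 (1%g : 'S_#|V|)) //= odd_perm1 expr0 mul1r.
rewrite [X in X + _]big1; last first.
  move=> a _; rewrite perm1 enum_rankK eqxx.
  case: eqVneq => //= au; rewrite ?subr0 // eq_sym.
  by rewrite (negPf (rooted_map_no_fix fr au)) subr0.
rewrite big1 ?addr0 // => s s1.
suff [a /eqP a0] : exists a, (a == enum_val (s (enum_rank a)))%:R
    - ((a != u) && (enum_val (s (enum_rank a)) == f a))%:R == 0 :> F.
  by rewrite (bigD1 a) //= a0 mul0r mulr0.
apply/existsP; apply: contraNT s1 => /existsPn s0.
pose t a := enum_val (s (enum_rank a)).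
have t_inj : injective t.
  by apply: inj_comp enum_val_inj _; apply: inj_comp enum_rank_inj; apply: perm_inj.
have tE a : t a = a \/ a != u /\ t a = f a.
  have := s0 a; rewrite -/(t a); have [|_] := eqVneq a (t a); first by left.
  by have [_|au] := eqVneq a u; have [->|] := eqVneq (t a) (f a) => //=;
    rewrite ?subrr ?eqxx //; right.
have t1 a : t a = a.
  have /andP[_ /forallP/(_ a)] := fr.
  move: a; apply: fconnect_ind => [|v vu tfv].
    by case: (tE u) => // -[]; rewrite eqxx.
  by case: (tE v) => // -[_ tv]; rewrite tv; apply: t_inj; rewrite tfv tv.
apply/eqP/permP=> i; rewrite perm1; apply: enum_val_inj.
by rewrite -[RHS]t1 /t enum_valK.
Qed.

(** Since the weights leaving [a] sum to 1, row [a] is the weighted mean of the rows that [a] has in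
    the matrices of single maps. Multilinearity then reduces the claim to [det_1sub_map]. *)
Lemma det_1sub_stochastic (F : fieldType) (c : V -> V -> F) :
  (forall a, \sum_b c a b = 1) ->
  \det (fmx (fun a b => (a == b)%:R - (a != u)%:R * c a b)) =
  \sum_(f in rooted_map) \prod_(v | v != u) c v (f v).
Proof.
move=> c1.
(* At the root all the weight is put on [u], so that only maps fixing [u] survive the expansion. *)
pose c' a k := if a == u then (k == u)%:R else c a k.
have E a b : (a == b)%:R - (a != u)%:R * c a b =
  \sum_k c' a k * ((a == b)%:R - ((a != u) && (b == k))%:R).
  have c'1 : \sum_k c' a k = 1.
    rewrite /c'; case: eqVneq => [_|//].
    by rewrite (bigD1 u) //= eqxx big1 ?addr0 // => k /negPf->.
  under eq_bigr do rewrite mulrBr; rewrite sumrB -mulr_suml c'1 mul1r.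
  congr (_ - _); rewrite /c'; case: eqVneq => /= _; rewrite ?mul0r ?mul1r.
    by rewrite big1 // => k _; rewrite mulr0.
  rewrite (bigD1 b) //= eqxx mulr1 big1 ?addr0 // => k.
  by rewrite eq_sym => /negPf->; rewrite mulr0.
rewrite (eq_fmx E) det_fmx_sum (bigID [pred f : {ffun V -> V} | f u == u]) /=.
rewrite [X in _ + X]big1 ?addr0; last first.
  by move=> f /negPf fu; rewrite (bigD1 u) //= /c' eqxx fu !mul0r.
rewrite [LHS]big_mkcond [RHS]big_mkcond; apply: eq_bigr => f _.
case: eqP => fu; last by rewrite inE /= (introF eqP fu).
rewrite det_1sub_map //; case: ifP => _; rewrite ?mulr0 // mulr1.
rewrite (bigD1 u) //= {1}/c' eqxx fu eqxx mul1r.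
by apply: eq_bigr => v /negPf vu; rewrite /c' vu.
Qed.
End MatrixTree.

(** * Spanning trees as parent functions *)

Section SpanningTrees.
Variables (V : finType) (E : {set V * V}) (u : V).

Definition tree_maps : {set {ffun V -> V}} :=
  [set f | (f \in rooted_map u) && [forall v, (v != u) ==> ((v, f v) \in E)]].

Definition map_edges (f : {ffun V -> V}) : {set V * V} :=
  [set (v, f v) | v in predC1 u].

Lemma in_map_edges f a b : ((a, b) \in map_edges f) = (a != u) && (b == f a).
Proof.
apply/imsetP/andP=> [[v vu [-> ->]]|[au /eqP->]]; last by exists a.
by rewrite inE in vu.
Qed.

Lemma map_edges_inj : {in rooted_map u &, injective map_edges}.
Proof.
move=> f g /andP[/eqP fu _] /andP[/eqP gu _] /setP fg.
apply/ffunP=> v; have [->|vu] := eqVneq v u; first by rewrite fu gu.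
by have := fg (v, f v); rewrite !in_map_edges vu eqxx => /esym/eqP.
Qed.

Lemma outdeg_map_edges f v : outdeg (map_edges f) v = (v != u).
Proof.
rewrite /outdeg; have [->|vu] := eqVneq v u.
  by apply: eq_card0 => w; rewrite inE in_map_edges eqxx.
apply/eqP/cards1P; exists (f v); apply/setP=> w.
by rewrite !inE in_map_edges vu.
Qed.

Lemma adjacent_sym (T : {set V * V}) : symmetric (adjacent T).
Proof. by move=> x y; apply: orbC. Qed.

Lemma rooted_map_connected f : f \in rooted_map u -> connected (map_edges f).
Proof.
case/andP=> _ /forallP fr.
have cu x : connect (adjacent (map_edges f)) x u.
  move: (fr x); elim/fconnect_ind: x / => [|v vu]; first exact: connect0.
  by apply: connect_trans; apply: connect1; rewrite /adjacent /= in_map_edges vu eqxx.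
apply/forallP=> x; apply/forallP=> y; apply: connect_trans (cu x) _.
by rewrite sym_connect_sym //; apply: adjacent_sym.
Qed.

(* A vertex of a cycle at maximal distance from the root would have both its
   neighbours on the cycle as parent. *)
Lemma rooted_map_acyclic f : f \in rooted_map u -> acyclic (map_edges f).
Proof.
move=> fR; have /andP[_ /forallP fr] := fR.
pose h v := findex f v u.
have hE v : v != u -> h v = (h (f v)).+1.
  by move=> vu; apply: fconnect_findex; rewrite 1?eq_sym.
apply/and3P; split.
- apply/forallP=> x; rewrite in_map_edges; apply/negP=> /andP[xu]; rewrite eq_sym.
  exact/negP/(rooted_map_no_fix fR).
- apply/forallP=> x; apply/forallP=> y; rewrite !in_map_edges.
  apply/negP=> /and3P[_ /andP[xu /eqP yE] /andP[yu /eqP xE]].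
  have := hE x xu; rewrite -yE (hE y yu) -xE => hx.
  by have := leqnSn (h x).+1; rewrite -hx ltnn.
apply/forallP=> n; apply/forallP=> c; apply/implyP=> n2; apply/negP=> /andP[cc uc].
have [m mc mmax] : exists2 m, m \in c & forall w, w \in c -> (h w <= h m)%N.
  have c0 : nth u c 0 \in c by rewrite mem_nth // size_tuple ltnW // ltnW.
  by case: (@arg_maxnP _ (nth u c 0) [in c] h c0) => m mc mmax; exists m.
have nbr w : w \in c -> adjacent (map_edges f) m w -> w = f m.
  move=> /mmax hw; rewrite /adjacent /= !in_map_edges => /orP[/andP[_ /eqP]|] //.
  by case/andP=> wu /eqP mw; move: hw; rewrite (hE w wu) -mw ltnn.
have [k c' rc] := rot_to mc.
have mem_c' w : w \in c' -> w \in c.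
  by move=> wc'; rewrite -(mem_rot k) rc inE wc' orbT.
have: (1 < size c')%N by have := size_rot k c; rewrite rc size_tuple -ltnS => /= ->.
rewrite -(rot_uniq k) rc in uc; rewrite -(rot_cycle k) rc in cc.
case: c' => [|y c'] // in rc mem_c' uc cc *.
case/lastP: c' => [|c' z] // in rc mem_c' uc cc *.
move=> _; have yz : y = z.
  have /= /andP[my] := cc; rewrite !rcons_path last_rcons => /andP[_ zm].
  have yc : y \in c by apply: mem_c'; apply: mem_head.
  have zc : z \in c by apply: mem_c'; rewrite inE mem_rcons mem_head orbT.
  by rewrite adjacent_sym in zm; rewrite (nbr y yc my) (nbr z zc zm).
by move: uc; rewrite /= yz mem_rcons mem_head andbF.
Qed.

(** The outdegree conditions turn a tree into a parent function. Its iterates reach [u] from every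
    vertex because the tree is connected. *)
Lemma spanning_trees_map_edges : spanning_trees E u = map_edges @: tree_maps.
Proof.
apply/setP=> T; rewrite inE; apply/idP/imsetP; last first.
  case=> f; rewrite inE => /andP[fR /forallP fE] ->; apply/and4P; split.
  - apply/subsetP=> -[a b]; rewrite in_map_edges => /andP[au /eqP->].
    by have := fE a; rewrite au.
  - by apply/andP; rewrite rooted_map_connected ?rooted_map_acyclic.
  - by rewrite outdeg_map_edges eqxx.
  - by apply/forallP=> v; apply/implyP=> vu; rewrite outdeg_map_edges vu.
case/and4P=> /subsetP TE /andP[/forallP Tc _] Tu /forallP T1.
pose f := [ffun v => if v == u then u else odflt v [pick w | (v, w) \in T]].
have TP a b : ((a, b) \in T) = (a != u) && (b == f a).
  rewrite ffunE; have [->|au] /= := eqVneq a u.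
    by move: Tu => /eqP/cards0_eq/setP/(_ b); rewrite !inE.
  have := T1 a; rewrite au => /cards1P[w /setP Tw].
  have {}Tw c : ((a, c) \in T) = (c == w) by have := Tw c; rewrite !inE.
  rewrite Tw; case: pickP => /= [c|/(_ w)]; last by rewrite Tw eqxx.
  by rewrite Tw => /eqP->.
have TfE : T = map_edges f by apply/setP=> -[a b]; rewrite TP in_map_edges.
exists f => //; rewrite inE; apply/andP; split; last first.
  by apply/forallP=> v; apply/implyP=> vu; apply: TE; rewrite TP vu eqxx.
rewrite inE /= {1}ffunE eqxx eqxx; apply/forallP=> v.
(* An edge joins a vertex to its parent, so both ends reach [u] or neither does: the vertices
   reaching [u] form a union of components. *)
have /closed_connect cl : closed (adjacent T) [pred v | fconnect f v u].
  move=> x y; rewrite /adjacent /= !inE !TP => /orP[]/andP[zu /eqP->].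
    by rewrite (fconnect_eqVf f x) (negPf zu).
  by rewrite (fconnect_eqVf f y) (negPf zu).
by have /cl := forallP (Tc v) u; rewrite !inE connect0.
Qed.

Lemma kappa_tree_maps : kappa E u = #|tree_maps|.
Proof.
rewrite /kappa spanning_trees_map_edges card_in_imset // => f g.
by rewrite !inE => /andP[fR _] /andP[gR _]; apply: map_edges_inj; rewrite inE.
Qed.

Lemma weighted_tree_sum_maps (w : V * V -> rat) :
  weighted_tree_sum E w u =
  \sum_(f in tree_maps) \prod_(v | v != u) w (v, f v).
Proof.
rewrite /weighted_tree_sum spanning_trees_map_edges big_imset /=; last first.
  move=> f g.
  by rewrite !inE => /andP[fR _] /andP[gR _]; apply: map_edges_inj; rewrite inE.
apply: eq_bigr => f _; rewrite big_imset //=.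
by move=> a b _ _ [].
Qed.

Lemma sum_rooted_map (c : V -> V -> rat) :
  (forall a b, (a, b) \notin E -> c a b = 0) ->
  \sum_(f in rooted_map u) \prod_(v | v != u) c v (f v) =
  \sum_(f in tree_maps) \prod_(v | v != u) c v (f v).
Proof.
move=> c0.
rewrite (bigID [pred f : {ffun V -> V} | [forall v, (v != u) ==> ((v, f v) \in E)]]) /=.
rewrite [X in _ + X]big1 ?addr0; last first.
  move=> f /andP[_ /forallPn[v]]; rewrite negb_imply => /andP[vu /c0 cv].
  by rewrite (bigD1 v) //= cv mul0r.
by apply: eq_bigl => f; rewrite [in RHS]inE.
Qed.
End SpanningTrees.

(** * Tree sums of the walks X Y and Y X *)

Section RandomWalks.
Variables (F : fieldType) (V J : finType) (X : J -> V -> F) (Y : V -> J -> F).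
Hypothesis X1 : forall j, \sum_v X j v = 1.
Hypothesis Y1 : forall v, \sum_j Y v j = 1.
Variables (d : V -> F) (u : V) (i : J).
Hypothesis d_stationary : forall w, \sum_v d v * (\sum_j Y v j * X j w) = d w.

(** If [d] is stationary for Y X, then d Y is stationary for X Y, and its mass at [i] is the sum on
    the right. Thus the ratio of rooted tree sum to stationary mass agrees for the two walks. *)
Lemma rooted_map_sum_factorisation :
  d u * \sum_(f in rooted_map i) \prod_(j | j != i) (\sum_v X j v * Y v (f j)) =
  (\sum_v d v * Y v i) *
    \sum_(f in rooted_map u) \prod_(v | v != u) (\sum_j Y v j * X j (f v)).
Proof.
have XY1 a : \sum_b \sum_v X a v * Y v b = 1.
  rewrite exchange_big -[RHS](X1 a) /=; apply: eq_bigr => v _.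
  by rewrite -mulr_sumr Y1 mulr1.
have YX1 a : \sum_b \sum_j Y a j * X j b = 1.
  rewrite exchange_big -[RHS](Y1 a) /=; apply: eq_bigr => j _.
  by rewrite -mulr_sumr X1 mulr1.
(* Zeroing row [i] of X deletes row [i] of the walk X Y, but subtracts only the rank-one matrix
   [y *m x] from Y X. *)
pose Xi j v := (j != i)%:R * X j v.
pose N : 'M_#|V| := 1%:M - fmx Y *m fmx X.
pose dv : 'rV[F]_#|V| := \row_k d (enum_val k).
pose y : 'cV[F]_#|V| := \col_k Y (enum_val k) i.
pose x : 'rV[F]_#|V| := \row_k X i (enum_val k).
rewrite -(det_1sub_stochastic i XY1) -(det_1sub_stochastic u YX1).
rewrite (@eq_fmx _ J J _ (fun a b => (a == b)%:R - \sum_v Xi a v * Y v b)); last first.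
  by move=> a b; rewrite mulr_sumr; under eq_bigr do rewrite mulrA.
rewrite -fmx1B -fmxM det_1sub_mulmxC.
have -> : 1%:M - fmx Y *m fmx Xi = N + y *m x.
  apply/matrixP=> a b; rewrite /N !fmxM !mxE big_ord1 !mxE -addrA; congr (_ + _).
  rewrite (bigD1 i) // [in RHS](bigD1 i) //= /Xi eqxx mul0r mulr0 add0r.
  rewrite opprD addrAC addNr add0r; congr (- _).
  by apply: eq_bigr => j ->; rewrite mul1r.
have := @det_add_rank1 _ _ N (enum_rank u) dv x y.
rewrite {1}[dv _ _]mxE enum_rankK => ->; last first.
  rewrite /N mulmxBr mulmx1 fmxM; apply/rowP=> k; rewrite !mxE.
  rewrite -[X in X - _]d_stationary.
  rewrite (big_enum_val (fun v => d v * (\sum_j Y v j * X j (enum_val k)))) /=.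
  apply/eqP; rewrite subr_eq0; apply/eqP; apply: eq_bigr => j _.
  by rewrite !mxE.
rewrite det_set_row; last first.
  apply/colP=> k; rewrite /N fmxM fmx1B !mxE.
  under eq_bigr do rewrite !mxE mulr1.
  rewrite -(big_enum_val (fun b => (enum_val k == b)%:R
    - \sum_j Y (enum_val k) j * X j b)) /=.
  rewrite sumrB YX1 (bigD1 (enum_val k)) //= eqxx big1 ?addr0 ?subrr // => b.
  by rewrite eq_sym => /negPf->.
have -> : \sum_j x 0 j = 1.
  by rewrite -(X1 i) (big_enum_val (X i)); apply: eq_bigr => k _; rewrite mxE.
rewrite mul1r; congr (_ * _); last congr (\det _).
  rewrite mxE (big_enum_val (fun v => d v * Y v i)).
  by apply: eq_bigr => k _; rewrite !mxE.
(* Putting the unit row at [u] into [N] gives exactly the matrix whose determinant is the tree sum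
   rooted at [u]. *)
apply/matrixP=> a b; rewrite /N fmxM fmx1B !mxE.
rewrite -(inj_eq enum_val_inj) enum_rankK; case: eqVneq => [->|_] /=.
  by rewrite mul0r subr0 -(inj_eq enum_val_inj) enum_rankK eq_sym.
by rewrite mul1r.
Qed.
End RandomWalks.

(** * Biclique partitions and the formula for rooted trees *)

Lemma div_prodD1 (F : fieldType) (T : finType) (g : T -> F) (t : T) : g t != 0 ->
  g t / \prod_x g x = \prod_(x | x != t) (g x)^-1.
Proof. by move=> gt; rewrite (bigD1 t) //= invfM mulrA divff // mul1r prodfV. Qed.

Section Bicliques.
Variables (V : finType) (E : {set V * V}) (r : nat).
Variables (Q : 'I_r -> {set V} * {set V}).
Hypotheses (hE : eulerian E) (hQ : biclique_partition E Q).

Lemma sum_mem_card (T : finType) (A : {set T}) : \sum_x (x \in A)%:R = #|A|%:R :> rat.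
Proof.
by rewrite -sumr_const [RHS]big_mkcond; apply: eq_bigr => x _; case: (x \in A).
Qed.

Lemma biclique_partition_count v w :
  \sum_j (v \in (Q j).1)%:R * (w \in (Q j).2)%:R = ((v, w) \in E)%:R :> rat.
Proof.
have [vwE|vwE] := boolP ((v, w) \in E).
  have [j []] := hQ.2 _ vwE; rewrite inE /= => /andP[vj wj] jP.
  rewrite (bigD1 j) //= vj wj mulr1 big1 ?addr0 // => k kj.
  rewrite -natrM mulnb; case: andP => // -[vk wk].
  by case/eqP: kj; rewrite (jP k) // inE /= vk.
rewrite big1 // => j _; rewrite -natrM mulnb; case: andP => // -[vj wj].
have [_ /subsetP/(_ (v, w))] := hQ.1 j.
by rewrite inE /= vj wj => /(_ isT) /(negP vwE).
Qed.

Lemma outdeg_sum v : (outdeg E v)%:R = \sum_w ((v, w) \in E)%:R :> rat.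
Proof. by rewrite -sum_mem_card; apply: eq_bigr => w _; rewrite inE. Qed.

Lemma indeg_sum w : (indeg E w)%:R = \sum_v ((v, w) \in E)%:R :> rat.
Proof. by rewrite -sum_mem_card; apply: eq_bigr => v _; rewrite inE. Qed.

(** A path from [v] to some other vertex begins with an edge at [v]; if that edge enters [v],
    balance supplies one that leaves it. *)
Lemma eulerian_outdeg_gt0 (a b : V) v : a != b -> (0 < outdeg E v)%N.
Proof.
move=> ab; have [c vc] : exists c, v != c.
  by have [->|va] := eqVneq v a; [exists b | exists a].
have [/forallP/(_ v)/forallP/(_ c)/connectP[[|w p] /= + cE] deg] := hE.
  by rewrite cE eqxx in vc.
case/andP=> /orP[vw|wv] _; last rewrite deg;
  by apply/card_gt0P; exists w; rewrite inE.
Qed.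

Lemma biclique_outdeg_gt0 (i : 'I_r) v : (0 < outdeg E v)%N.
Proof.
have [[/set0Pn[a aQ] /set0Pn[b bQ] /disjointFr Q12] _] := hQ.1 i.
apply: (@eulerian_outdeg_gt0 a b).
by apply: contraTneq bQ => <-; rewrite Q12.
Qed.

(** The walks are specialised so that the step from [j] to [k] of X Y has probability
    [Theta_weight E Q (j, k) / s j], and the step of Y X along an edge leaving [v] has probability
    [1 / d v]. The edge counts balance, so the outdegrees are stationary. *)
Lemma kappa_Theta u i :
  (kappa E u)%:R =
    (\prod_(v : V) (outdeg E v)%:R) / (\prod_(j < r) #|(Q j).2|%:R)
    * (weighted_tree_sum (Theta_edges Q) (Theta_weight E Q) i
       / #|(Q i).1|%:R) :> rat.
Proof.
pose d v : rat := (outdeg E v)%:R.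
pose s j : rat := #|(Q j).2|%:R.
have s0 j : s j != 0.
  have [[_ Q2 _] _] := hQ.1 j.
  by rewrite Num.Theory.pnatr_eq0 cards_eq0.
have p0 : #|(Q i).1|%:R != 0 :> rat.
  by have [[Q1 _ _] _] := hQ.1 i; rewrite Num.Theory.pnatr_eq0 cards_eq0.
have d0 v : d v != 0 by rewrite Num.Theory.pnatr_eq0 -lt0n (biclique_outdeg_gt0 i).
pose X j v := (v \in (Q j).2)%:R / s j.
pose Y v j := (v \in (Q j).1)%:R * s j / d v.
have YX v w : \sum_j Y v j * X j w = ((v, w) \in E)%:R / d v.
  rewrite -biclique_partition_count mulr_suml; apply: eq_bigr => j _.
  by rewrite /X /Y; field; rewrite s0 d0.
have X1 j : \sum_v X j v = 1 by rewrite -mulr_suml sum_mem_card -/(s j) divff.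
(* The bicliques with [v] in their first part split the edges leaving [v]. *)
have Y1 v : \sum_j Y v j = 1.
  rewrite -mulr_suml; apply: (mulIf (d0 v)); rewrite mul1r divfK // /d outdeg_sum.
  under [RHS]eq_bigr do rewrite -biclique_partition_count.
  rewrite exchange_big; apply: eq_bigr => j _.
  by rewrite -mulr_sumr sum_mem_card.
have stat w : \sum_v d v * (\sum_j Y v j * X j w) = d w.
  rewrite /d hE.2 indeg_sum; apply: eq_bigr => v _.
  by rewrite YX mulrC divfK.
have := rooted_map_sum_factorisation X1 Y1 u i stat.
(* The stationary mass of a biclique is its number of edges. *)
have -> : \sum_v d v * Y v i = #|(Q i).1|%:R * s i.
  rewrite -sum_mem_card mulr_suml; apply: eq_bigr => v _.
  by rewrite /Y mulrC divfK.
rewrite (@sum_rooted_map _ (Theta_edges Q) i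
  (fun j k => \sum_v X j v * Y v k)); last first.
  move=> j k; rewrite inE negbK => /eqP/setP jk.
  rewrite big1 // => v _; rewrite /X /Y; have := jk v; rewrite !inE.
  by case: (v \in _); case: (v \in _) => //= _; rewrite ?mul0r ?mulr0.
rewrite (@sum_rooted_map _ E u (fun v w => \sum_j Y v j * X j w)); last first.
  by move=> v w /negPf vw; rewrite YX vw mul0r.
have -> : \sum_(f in tree_maps (Theta_edges Q) i)
     \prod_(j | j != i) (\sum_v X j v * Y v (f j))
  = weighted_tree_sum (Theta_edges Q) (Theta_weight E Q) i * (s i / \prod_j s j).
  rewrite weighted_tree_sum_maps mulr_suml; apply: eq_bigr => f _.
  rewrite div_prodD1 // -big_split /=.
  apply: eq_bigr => j _; rewrite /Theta_weight /= mulr_sumr mulr_suml [RHS]big_mkcond.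
  apply: eq_bigr => v _; rewrite inE /X /Y -/(s _).
  case: (v \in _); case: (v \in _); rewrite /= ?mul0r ?mulr0 ?mul1r //.
  by rewrite mulrC.
have -> : \sum_(f in tree_maps E u) \prod_(v | v != u) (\sum_j Y v j * X j (f v))
  = (kappa E u)%:R * (d u / \prod_v d v).
  rewrite kappa_tree_maps -sumr_const mulr_suml; apply: eq_bigr => f.
  rewrite inE => /andP[_ /forallP fE].
  rewrite div_prodD1 // mul1r.
  by apply: eq_bigr => v vu; rewrite YX; have := fE v; rewrite vu /= => ->; rewrite mul1r.
have D0 : \prod_v d v != 0 by apply/prodf_neq0.
have S0 : \prod_j s j != 0 by apply/prodf_neq0.
rewrite -[\prod_v (outdeg E v)%:R]/(\prod_v d v).
rewrite -[\prod_(j < r) #|(Q j).2|%:R]/(\prod_j s j).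
(* It remains to solve du * (t * (si / S)) = p * si * (K * (du / D)) for K, all factors other than t
   and K being nonzero. *)
move: (s0 i) (d0 u) p0 D0 S0; move: (weighted_tree_sum _ _ _) (s i) (d u).
move: (#|_|%:R) (\prod_v _) (\prod_j _) ((kappa E u)%:R).
move=> p S D K t si du si0 du0 p0' D0 S0 eq_t.
apply: (mulfI p0'); apply: (mulfI si0); apply: (mulfI du0).
transitivity (p * si * (K * (du / D)) * D); first by field.
by rewrite -eq_t; field; rewrite p0' S0.
Qed.
End Bicliques.

(** * Trails and their exit lists *)

Section Trails.
Local Open Scope nat_scope.
Variable V : finType.
Implicit Types (s t : seq (V * V)) (u v w x y : V).

Fixpoint trail x s y : bool :=
  if s is e :: s' then (e.1 == x) && trail e.2 s' y else x == y.

(** The heads are kept in the order of traversal; these lists are the code of a circuit in the BEST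
    bijection. *)
Definition exits s v : seq V := [seq e.2 | e <- s & e.1 == v].

Lemma exits_cons e s v :
  exits (e :: s) v = if e.1 == v then e.2 :: exits s v else exits s v.
Proof. by rewrite /exits /=; case: ifP. Qed.

Lemma size_exits s v : size (exits s v) = count (fun e => e.1 == v) s.
Proof. by rewrite size_map size_filter. Qed.

Lemma mem_exits s v w : (w \in exits s v) = ((v, w) \in s).
Proof.
apply/mapP/idP=> [[[a b]] + ->|vws]; last by exists (v, w); rewrite // mem_filter eqxx.
by rewrite mem_filter => /= /andP[/eqP->].
Qed.

Lemma count_exits s v w : count_mem w (exits s v) = count_mem (v, w) s.
Proof.
rewrite count_map count_filter; apply: eq_count => -[a b].
by rewrite /= xpair_eqE andbC.
Qed.

Lemma uniq_exits s v : uniq s -> uniq (exits s v).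
Proof.
move=> us; apply/count_mem_uniq => w.
by rewrite count_exits count_uniq_mem // mem_exits.
Qed.

Lemma exits_uniq s : (forall v, uniq (exits s v)) -> uniq s.
Proof.
move=> us; apply/count_mem_uniq => -[v w].
by rewrite -count_exits count_uniq_mem // mem_exits.
Qed.

Lemma cycle_trail e s :
  cycle (fun e f : V * V => e.2 == f.1) (e :: s) = trail e.1 (e :: s) e.1.
Proof.
rewrite /= eqxx /=; elim: s {1 3}e => [|f s IHs] a /=; first by rewrite andbT.
by rewrite IHs eq_sym.
Qed.

Lemma trail_balance x s y v : trail x s y ->
  count (fun e => e.1 == v) s + (y == v) = count (fun e => e.2 == v) s + (x == v).
Proof.
elim: s x => [|e s IHs] x /=; first by move=> /eqP->.
case/andP=> /eqP<- /IHs; rewrite -addnA => ->.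
by rewrite addnC; congr (_ + _); apply: addnC.
Qed.

(* A trail is replayed from its exit lists: the next edge leaves along the
   first unused exit. *)
Lemma trail_inj x s t y z : trail x s y -> trail x t z ->
  exits s =1 exits t -> s = t.
Proof.
elim: s x t => [|e s IHs] x [|f t] //=.
- by move=> _ /andP[_ _] /(_ f.1); rewrite exits_cons eqxx.
- by move=> /andP[_ _] _ /(_ e.1); rewrite exits_cons eqxx.
case/andP=> /eqP ex st /andP[/eqP fx tt] ef.
have [e2 _] : e.2 = f.2 /\ exits s x = exits t x.
  by have := ef x; rewrite !exits_cons ex fx eqxx => -[].
have ef_eq : e = f by rewrite [e]surjective_pairing ex e2 -fx -surjective_pairing.
subst f; congr cons; apply: IHs st tt _ => v.
by have := ef v; rewrite !exits_cons; case: ifP => // _ [].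
Qed.

Lemma trail_exists (g : V -> seq V) x : exists s y (h : V -> seq V),
  [/\ trail x s y, h y = [::] & forall v, g v = exits s v ++ h v].
Proof.
move: {2}(\sum_v _) (leqnn (\sum_v size (g v))) => n.
elim: n g x => [|n IHn] g x le_n.
  exists [::], x, g; split; rewrite //= ?eqxx //; apply: size0nil; apply/eqP.
  by rewrite -leqn0; apply: leq_trans le_n; rewrite (bigD1 x) //= leq_addr.
case gx: (g x) => [|w l]; first by exists [::], x, g; rewrite /= eqxx.
pose g' v := if v == x then l else g v.
have [|s [y [h [st hy gh]]]] := IHn g' w.
  rewrite -ltnS; apply: leq_trans le_n; rewrite (bigD1 x) // [X in _ < X](bigD1 x) //=.
  rewrite {1}/g' eqxx gx /= addSn ltnS leq_add2l leq_eqVlt; apply/orP; left.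
  by apply/eqP/eq_bigr => v /negPf vx; rewrite /g' vx.
exists ((x, w) :: s), y, h; split=> // [|v]; first by rewrite /= eqxx.
rewrite exits_cons /= eq_sym; have := gh v; rewrite /g'.
by case: eqVneq => [->|_] // lE; rewrite gx lE.
Qed.

(* After the last exit from [v] along [(v, f v)], either [f v] is the end of the
   trail or it is left again later. *)
Lemma last_exit_rooted (f : V -> V) x s u : trail x s u ->
  (forall v, v != u -> exits s v != [::] -> f v = last v (exits s v)) ->
  fconnect f x u /\ (forall v, exits s v != [::] -> fconnect f v u).
Proof.
elim: s x => [|e s IHs] x /=; first by move=> /eqP->.
case/andP=> /eqP ex st fE.
have [|f2 fs] := IHs _ st.
  move=> v vu sv; rewrite fE // exits_cons; case: ifP => //.
  by case: (exits s v) sv.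
suff fxu : fconnect f x u.
  split=> // v; rewrite exits_cons ex; case: (eqVneq x v) => [<-|_] //; last exact: fs.
have [->//|xu] := eqVneq x u.
have [sx|] := eqVneq (exits s x) [::]; last exact: fs.
by rewrite fconnect_eqVf fE //; rewrite exits_cons ex eqxx // sx /= f2 orbT.
Qed.

End Trails.

(** * The BEST theorem *)

Section Best.
Local Open Scope nat_scope.

Lemma card_bseq_mem (T : finType) n (X : seq (seq T)) : uniq X ->
  (forall l, l \in X -> size l <= n) ->
  #|[pred l : {bseq n of T} | val l \in X]| = size X.
Proof.
move=> uX sX; rewrite cardE -(size_map val); apply/perm_size/uniq_perm => //.
  by rewrite (map_inj_uniq val_inj) enum_uniq.
move=> l; apply/mapP/idP=> [[b]|lX].
  by rewrite mem_enum inE => bX ->.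
by exists (Bseq (sX l lX)); rewrite ?mem_enum.
Qed.

Lemma perm_enumD1 (T : finType) (A : {set T}) a : a \in A ->
  perm_eq (enum A) (a :: enum (A :\ a)).
Proof.
move=> aA; apply: uniq_perm; rewrite ?enum_uniq //=.
  by rewrite enum_uniq mem_enum !inE eqxx.
by move=> x; rewrite inE !mem_enum !inE; case: eqVneq => [->|].
Qed.

Section Circuits.
Variables (V : finType) (E : {set V * V}) (u w0 : V).
Hypotheses (balanced : forall v, outdeg E v = indeg E v).
Hypothesis (outdeg_gt0 : forall v, 0 < outdeg E v).
Hypothesis (uw0 : (u, w0) \in E).

Local Notation system := {ffun V -> {bseq #|V| of V}}.

Let outs v : {set V} := [set w | (v, w) \in E].

Lemma count_in_le s w : uniq s -> {subset s <= E} ->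
  count (fun e : V * V => e.2 == w) s <= indeg E w.
Proof.
move=> us sE; rewrite -size_filter -(size_map fst) /indeg cardE.
apply: uniq_leq_size.
  rewrite map_inj_in_uniq ?filter_uniq // => -[a b] [c d].
  by rewrite !mem_filter /= => /andP[/eqP-> _] /andP[/eqP-> _] ->.
move=> v /mapP[[a b]]; rewrite mem_filter => /= /andP[/eqP-> /sE abE] ->.
by rewrite mem_enum inE.
Qed.

(* If [v] had an unused exit, its last one [(v, f v)] would be unused, so by
   balance [f v] would have an unused exit as well, and so on up to the root. *)
Lemma trail_exhausts (g h : V -> seq V) (f : V -> V) s y :
  (forall v, perm_eq (g v) (enum (outs v))) ->
  (forall v, v != u -> f v = last v (g v)) -> (forall v, fconnect f v u) ->
  trail u s y -> h y = [::] -> (forall v, g v = exits s v ++ h v) ->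
  y = u /\ forall v, h v = [::].
Proof.
move=> gP fE fr st hy gE.
have ug v : uniq (exits s v ++ h v) by rewrite -gE (perm_uniq (gP v)) enum_uniq.
have us : uniq s by apply: exits_uniq => v; have := ug v; rewrite cat_uniq => /andP[].
have mem_g v w : (w \in g v) = ((v, w) \in E) by rewrite (perm_mem (gP v)) mem_enum inE.
have sE : {subset s <= E}.
  by case=> v w; rewrite -mem_exits -mem_g gE mem_cat => ->.
have out_full v : h v = [::] -> count (fun e => e.1 == v) s = outdeg E v.
  by move=> hv; rewrite -size_exits -[exits s v]cats0 -hv -gE (perm_size (gP v)) -cardE.
(* All exits of the end vertex [y] are used. If [y] were not the start, it would have been entered
   once more than it was left, exceeding its indegree. *)
have yu : y = u.
  apply/eqP; have := trail_balance y st; rewrite out_full // eqxx addn1 eq_sym.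
  case: eqVneq => // _; rewrite addn0 => le_in.
  by have := count_in_le y us sE; rewrite -le_in balanced ltnn.
subst y; split=> // v.
move: (fr v); elim/fconnect_ind: v / => // v vu hfv.
case hv: (h v) => [//|a l].
have fh : f v \in h v by rewrite fE // gE last_cat hv /= mem_last.
have vs : (v, f v) \notin s.
  by have := ug v; rewrite cat_uniq -mem_exits => /and3P[_ /hasPn/(_ _ fh)].
have := @count_in_le ((v, f v) :: s) (f v); rewrite /= vs us eqxx.
have -> : count (fun e => e.2 == f v) s = outdeg E (f v).
  by have := trail_balance (f v) st; rewrite out_full // => /addIn.
rewrite balanced add1n ltnn => in_lt; suff: false by [].
apply: in_lt => // e; rewrite inE => /predU1P[->|/sE //].
by rewrite -mem_g gE mem_cat fh orbT.
Qed.

(* The possible exit lists at [v] of an Eulerian circuit starting with [(u, w0)]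
   whose last exits from the vertices other than [u] are given by [f]. *)
Definition exit_orders (f : V -> V) v : seq (seq V) :=
  if v == u then [seq w0 :: l | l <- permutations (enum (outs u :\ w0))]
  else [seq rcons l (f v) | l <- permutations (enum (outs v :\ f v))].

Lemma mem_exit_orders (f : V -> V) v l : (v != u -> (v, f v) \in E) ->
  (l \in exit_orders f v) = perm_eq l (enum (outs v)) &&
    (if v == u then ohead l == Some w0 else last v l == f v).
Proof.
rewrite /exit_orders; case: eqVneq => [->|vu] /= fE.
  have w0A : w0 \in outs u by rewrite inE.
  rewrite (permPr (perm_enumD1 w0A)); apply/mapP/andP=> [[l' + ->]|[]].
    by rewrite mem_permutations perm_cons eqxx.
  case: l => //= x l + /eqP[xw]; rewrite xw perm_cons => lP.
  by exists l; rewrite ?mem_permutations.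
have fA : f v \in outs v by rewrite inE fE.
rewrite (permPr (perm_enumD1 fA)); apply/mapP/andP=> [[l' + ->]|[]].
  by rewrite mem_permutations perm_rcons perm_cons last_rcons eqxx.
case/lastP: l => [|l x]; first by move/perm_size.
rewrite last_rcons perm_rcons => + /eqP xf; rewrite xf perm_cons => lP.
by exists l; rewrite ?mem_permutations.
Qed.

Lemma uniq_exit_orders f v : uniq (exit_orders f v).
Proof.
rewrite /exit_orders; case: ifP => _; rewrite map_inj_uniq ?permutations_uniq //.
  by move=> l1 l2 [].
by move=> l1 l2 /rcons_inj[].
Qed.

(** One exit is pinned, the first at [u] and the last elsewhere; the others are permuted freely. *)
Lemma size_exit_orders (f : V -> V) v : (v != u -> (v, f v) \in E) ->
  size (exit_orders f v) = (outdeg E v).-1`!.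
Proof.
have sz a (A : {set V}) : a \in A -> size (permutations (enum (A :\ a))) = #|A|.-1`!.
  by move=> aA; rewrite size_permutations ?enum_uniq // -cardE (cardsD1 a A) aA.
rewrite /exit_orders /outdeg; case: eqVneq => [-> _|_ /(_ isT) vf];
  by rewrite size_map sz // inE.
Qed.

Lemma perm_outs_size l v : perm_eq l (enum (outs v)) -> size l <= #|V|.
Proof. by move/perm_size->; rewrite -cardE max_card. Qed.

(** Bounding the lists by [#|V|] makes the systems a finite type and loses no circuit, since the
    exits of a circuit at a vertex are distinct. *)
Definition exit_systems : {set system} :=
  [set g : system |
    [exists f in tree_maps E u, [forall v, val (g v) \in exit_orders f v]]].

(** A system determines its tree through the last exits, so the systems fibre over [tree_maps], and
    each fibre is a product of the sets of exit orders. *)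
Lemma card_exit_systems :
  #|exit_systems| = kappa E u * \prod_v (outdeg E v).-1`!.
Proof.
pose L (g : system) :=
  [ffun v => if v == u then u else last v (g v)].
have LE (f : {ffun V -> V}) (g : system) : f \in tree_maps E u ->
    (forall v, val (g v) \in exit_orders f v) -> L g = f.
  rewrite inE => /andP[/andP[/eqP fu _] /forallP/= fE] gf.
  apply/ffunP=> v; rewrite ffunE; have [->//|vu] := eqVneq v u.
  have := gf v; rewrite mem_exit_orders; last by move=> _; have := fE v; rewrite vu.
  by rewrite (negPf vu) => /andP[_ /eqP].
rewrite -sum1_card (partition_big L [in tree_maps E u]) /=; last first.
  by move=> g; rewrite inE => /exists_inP[f fT /forallP/(LE _ _ fT)->].
rewrite kappa_tree_maps -sum_nat_const; apply: eq_bigr => f fT.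
have fE v : v != u -> (v, f v) \in E.
  by move=> vu; move: fT; rewrite inE => /andP[_ /forallP/(_ v)]; rewrite vu.
pose F v := [pred l : {bseq #|V| of V} | val l \in exit_orders f v].
transitivity #|family F|.
  rewrite -[RHS]sum1_card; apply: eq_bigl => g; apply/andP/familyP=> [[]|gF].
    rewrite inE => /exists_inP[f' f'T /forallP gf'] /eqP Lf v.
    by rewrite inE -Lf (LE _ _ f'T).
  split; last by apply/eqP/LE.
  by rewrite inE; apply/exists_inP; exists f => //; apply/forallP.
rewrite card_family foldrE big_image /=; apply: eq_bigr => v _.
rewrite card_bseq_mem ?uniq_exit_orders ?size_exit_orders => //; first exact: fE.
by move=> l; rewrite mem_exit_orders => [/andP[/perm_outs_size]|]; [|apply: fE].
Qed.

Definition circuits_from (e : V * V) : {set #|E|.-tuple (V * V)} :=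
  [set s in rooted_eulerian_circuits E | ohead s == Some e].

Definition exit_system (s : #|E|.-tuple (V * V)) : system :=
  [ffun v => insub_bseq #|V| (exits s v)].

Lemma circuits_fromP (s : #|E|.-tuple (V * V)) :
  reflect [/\ trail u s u, uniq s, s =i E & ohead s = Some (u, w0)]
    (s \in circuits_from (u, w0)).
Proof.
rewrite inE; apply: (iffP andP) => [[]|[st us sE s0]].
  rewrite inE => /and3P[cs us /eqP/setP sE] /eqP s0; split=> // [|e]; last first.
    by rewrite -sE inE.
  by case: (tval s) s0 cs => // e t [->]; rewrite cycle_trail.
split; last exact/eqP.
rewrite inE us; apply/and3P; split=> //; last by apply/eqP/setP=> e; rewrite inE sE.
by case: (tval s) s0 st => // e t [->]; rewrite cycle_trail.
Qed.

Lemma perm_exits (s : seq (V * V)) v : uniq s -> s =i E ->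
  perm_eq (exits s v) (enum (outs v)).
Proof.
move=> us sE; apply: uniq_perm; rewrite ?enum_uniq ?uniq_exits // => w.
by rewrite mem_exits mem_enum inE sE.
Qed.

Lemma exit_systemE (s : #|E|.-tuple (V * V)) v : s \in circuits_from (u, w0) ->
  val (exit_system s v) = exits s v.
Proof.
case/circuits_fromP=> _ us sE _; rewrite ffunE /insub_bseq insubdK //.
exact: perm_outs_size (perm_exits v us sE).
Qed.

Lemma exit_system_inj : {in circuits_from (u, w0) &, injective exit_system}.
Proof.
move=> s t sC tC st; apply/val_inj.
have /circuits_fromP[ss _ _ _] := sC; have /circuits_fromP[tt _ _ _] := tC.
apply: (trail_inj ss tt) => v.
by rewrite -(exit_systemE v sC) -(exit_systemE v tC) st.
Qed.

(** The last exits of a circuit form a tree by [last_exit_rooted]. Conversely, the greedy trail of a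
    system closes up at [u] and uses every edge by [trail_exhausts]. *)
Lemma exit_system_imset : exit_system @: circuits_from (u, w0) = exit_systems.
Proof.
apply/setP=> g; apply/imsetP/idP=> [[s sC ->]|].
  have /circuits_fromP[st us sE s0] := sC.
  pose f := [ffun v => if v == u then u else last v (exits s v)].
  have exits0 v : exits s v != [::].
    have /card_gt0P[w] := outdeg_gt0 v; rewrite inE -sE -mem_exits.
    by case: (exits s v).
  have fE v : v != u -> (v, f v) \in E.
    move=> /negPf vu; rewrite ffunE vu -sE -mem_exits.
    by case: (exits s v) (exits0 v) => //= x l _; apply: mem_last.
  rewrite inE; apply/exists_inP; exists f.
    rewrite inE; apply/andP; split; last first.
      by apply/forallP=> v; apply/implyP/fE.
    rewrite inE /= {1}ffunE eqxx eqxx; apply/forallP=> v.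
    have [|_ ->//] := last_exit_rooted (f := f) st.
    by move=> w /negPf wu _; rewrite ffunE wu.
  apply/forallP=> v; rewrite exit_systemE // mem_exit_orders; last exact: fE.
  rewrite perm_exits //; case: eqVneq => [->|vu] /=; last by rewrite ffunE (negPf vu).
  by case: (tval s) s0 => //= e t [->]; rewrite exits_cons eqxx.
rewrite inE => /exists_inP[f]; rewrite inE.
case/andP=> /andP[/eqP fu /forallP/= fr] /forallP fE.
have {}fE v : v != u -> (v, f v) \in E by move=> vu; have := fE v; rewrite vu.
move=> /forallP gf.
have gP v : perm_eq (g v) (enum (outs v)).
  by have := gf v; rewrite (mem_exit_orders _ (fE v)) => /andP[].
have gl v : v != u -> f v = last v (g v).
  move=> vu; have := gf v; rewrite (mem_exit_orders _ (fE v)) (negPf vu).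
  by case/andP=> _ /eqP.
have [s [y [h [st hy gE]]]] := trail_exists (fun v => val (g v)) u.
have [yu h0] := trail_exhausts gP gl fr st hy gE.
subst y; have {}gE v : val (g v) = exits s v by rewrite gE h0 cats0.
have us : uniq s by apply: exits_uniq => v; rewrite -gE (perm_uniq (gP v)) enum_uniq.
have sE : s =i E.
  by case=> v w; rewrite -mem_exits -gE (perm_mem (gP v)) mem_enum inE.
have szs : size s == #|E| by rewrite -(card_uniqP us); apply/eqP/eq_card.
have s0 : ohead s = Some (u, w0).
  have := gf u; rewrite (mem_exit_orders _ (fE u)) eqxx gE => /andP[_].
  case: (s) st => [|[a b] t] //= /andP[/eqP-> _].
  by rewrite exits_cons eqxx /= => /eqP[->].
have sC : Tuple szs \in circuits_from (u, w0) by apply/circuits_fromP.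
exists (Tuple szs) => //; apply/ffunP=> v; apply/val_inj.
by rewrite exit_systemE.
Qed.

Lemma card_circuits_from :
  #|circuits_from (u, w0)| = kappa E u * \prod_v (outdeg E v).-1`!.
Proof.
by rewrite -card_exit_systems -exit_system_imset (card_in_imset exit_system_inj).
Qed.

End Circuits.

(** A circuit traverses [e] exactly once, so each rotation class has exactly one member starting
    with [e]: these circuits form a transversal. *)
Lemma num_eulerian_circuits_from (V : finType) (E : {set V * V}) e : e \in E ->
  num_eulerian_circuits E = #|circuits_from E e|.
Proof.
move=> eE; set R := rooted_eulerian_circuits E.
have rotP (s t : #|E|.-tuple (V * V)) :
    reflect (exists k, rot k s = t :> seq _) (rotation_of s t).
  apply: (iffP existsP) => [[k /eqP]|[k]]; first by exists k.
  rewrite rot_minn size_tuple => kst.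
  have lk : minn k #|E| < #|E|.+1 by rewrite ltnS geq_minr.
  by exists (Ordinal lk); rewrite /= kst.
have rot_refl s : rotation_of (E := E) s s by apply/rotP; exists 0; rewrite rot0.
have rot_sym s t : rotation_of (E := E) s t -> rotation_of t s.
  case/rotP=> k kE; apply/rotP; exists (size (rot k s) - k).
  by rewrite -kE; apply: rotK.
have rot_trans s t r : rotation_of (E := E) s t -> rotation_of t r -> rotation_of s r.
  case/rotP=> k kE /rotP[l lE]; apply/rotP; exists (rot_add s k l).
  by rewrite -rot_rot_add kE.
have rot_equiv : {in R & &, equivalence_rel (@rotation_of V E)}.
  move=> s t r _ _ _; split=> // st; apply/idP/idP; last exact: rot_trans.
  exact/rot_trans/rot_sym.
symmetry; apply: (@card_transversal _ _ _ R); apply/and3P; split.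
- exact: equivalence_partitionP.
- by apply/subsetP=> s; rewrite inE => /andP[].
apply/forall_inP=> _ /imsetP[s sR ->].
have [cs us sE] : [/\ cycle (fun e f : V * V => e.2 == f.1) s, uniq s & s =i E].
  move: sR; rewrite inE => /and3P[cs us /eqP/setP sE]; split=> // x.
  by rewrite -sE inE.
have [k s' rs] := rot_to (etrans (sE e) eE).
have s_rs : rotation_of s (rot_tuple k s) by apply/rotP; exists k.
have us' : e \notin s' by move: us; rewrite -(rot_uniq k) rs => /andP[].
apply/cards1P; exists (rot_tuple k s); apply/setP=> t; rewrite !inE.
apply/idP/eqP => [|->]; last first.
  rewrite s_rs rot_cycle rot_uniq cs us /= rs eqxx !andbT.
  by rewrite andbb; apply/eqP/setP=> x; rewrite inE -rs mem_rot sE.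
case/andP=> /andP[_ /eqP t0] /andP[_ st].
have /rotP[m mE] := rot_trans _ _ _ (rot_sym _ _ s_rs) st.
apply: val_inj; rewrite /= -mE /= rs; rewrite -mE /= rs in t0.
(* Rotating [e :: s'] by [m.+1] gives a list starting inside [s'], which avoids [e], unless the
   rotation is a full turn. *)
case: m t0 {mE} => [|m]; first by rewrite rot0.
rewrite /rot /=; case dm: (drop m s') => [|x l] /=.
  by rewrite take_oversize // -subn_eq0 -size_drop dm.
by case=> xe; case/negP: us'; apply: (@mem_drop m); rewrite dm xe mem_head.
Qed.

End Best.

Theorem corollary3p4 (V : finType) (E : {set V * V})
    (r : nat) (Q : 'I_r -> {set V} * {set V})
    (hE : eulerian E) (hQ : biclique_partition E Q) (u : V) (i : 'I_r) :
  (kappa E u)%:R =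
    (\prod_(v : V) (outdeg E v)%:R) / (\prod_(j < r) #|(Q j).2|%:R)
    * (weighted_tree_sum (Theta_edges Q) (Theta_weight E Q) i
       / #|(Q i).1|%:R) :> rat
  /\
  (num_eulerian_circuits E)%:R =
    (\prod_(v : V) ((outdeg E v)`!)%:R) / (\prod_(j < r) #|(Q j).2|%:R)
    * (weighted_tree_sum (Theta_edges Q) (Theta_weight E Q) i
       / #|(Q i).1|%:R) :> rat.
Proof.
split; first exact: kappa_Theta.
have d_gt0 := biclique_outdeg_gt0 hE hQ i.
have [w0] := card_gt0P (d_gt0 u); rewrite inE => uw0.
rewrite (num_eulerian_circuits_from uw0) (card_circuits_from hE.2 d_gt0 uw0).
rewrite natrM (kappa_Theta hE hQ u i) natr_prod.
have -> : \prod_v ((outdeg E v)`!)%:R =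
    (\prod_v (outdeg E v)%:R) * \prod_v ((outdeg E v).-1`!)%:R :> rat.
  rewrite -big_split; apply: eq_bigr => v _ /=.
  by rewrite -natrM -{1 2}(prednK (d_gt0 v)) factS.
by ring.
Qed.
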